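(* Let $i\in\mathbb{V}$ be a vertex of height one. Then the GMRES method applied to $\mathcal{B}_{\le i}$ with preconditioner $\mathcal{P}^{\mathrm{hook}}_{\le i}$ converges in at most two iterations in exact arithmetic; that is, for every right-hand side $h$ and every initial guess $x^{(0)}$, the exact solution $\mathcal{B}_{\le i}^{-1}h$ is obtained after at most two GMRES iterations.
   Context: **Data.** Let $\mathbb{D}=(\mathbb{V},\mathbb{A})$ be a directed rooted tree (arborescence) with vertices $\mathbb{V}=\{1,\dots,N\}$ and arcs $\mathbb{A}=\{a_1,\dots,a_M\}$ directed away from the root $R$. Each vertex $i$ has a symmetric matrix $B_i\in\mathbb{R}^{n_i\times n_i}$; each arc $a_k=(i,j)$ has a symmetric $D_k\in\mathbb{R}^{\ell_k\times\ell_k}$ and matrices $C_k^+\in\mathbb{R}^{\ell_k\times n_i}$, $C_k^-\in\mathbb{R}^{\ell_k\times n_j}$. A vertex is a leaf if it has no outgoing arcs, and an inner vertex otherwise. The height of a leaf is zero, and the height of an inner vertex is one plus the maximum height of its children. For $i\neq R$ let $\kappa(i)$ be the index of the unique arc entering $i$. For an inner vertex $i$ write its outgoing arcs as $a_{k_1}=(i,j_1),\dots,a_{k_r}=(i,j_r)$. **Nested matrices.** For a leaf $i$: $\mathcal{B}_{\le i}=B_i$, and $\mathcal{C}_i^-=C^-_{\kappa(i)}$ if $i\ne R$. For an inner vertex $i$: $\mathcal{D}_{\le i}=\mathrm{blkdiag}(D_{k_1},\dots,D_{k_r})$, $\mathcal{C}^+_{\le i}$ is the vertical stacking of $C^+_{k_1},\dots,C^+_{k_r}$,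 $\mathcal{C}^-_{\le i}=\mathrm{blkdiag}(\mathcal{C}^-_{j_1},\dots,\mathcal{C}^-_{j_r})$, and $$\mathcal{B}_{\le i}=\begin{pmatrix}\mathrm{blkdiag}(\mathcal{B}_{\le j_1},\dots,\mathcal{B}_{\le j_r}) & 0 & -(\mathcal{C}^-_{\le i})^T\\ 0 & B_i & (\mathcal{C}^+_{\le i})^T\\ -\mathcal{C}^-_{\le i} & \mathcal{C}^+_{\le i} & -\mathcal{D}_{\le i}\end{pmatrix};$$ for $i\neq R$, $\mathcal{C}_i^-=(0\ \cdots\ 0\ C^-_{\kappa(i)}\ 0)$, where $C^-_{\kappa(i)}$ occupies the columns of $\mathcal{B}_{\le i}$ containing the diagonal block $B_i$. For inner $i$, $$\mathcal{S}_{\le i}=\begin{pmatrix}-\mathcal{C}^-_{\le i}&\mathcal{C}^+_{\le i}\end{pmatrix}\mathrm{blkdiag}(\mathcal{B}_{\le j_1}^{-1},\dots,\mathcal{B}_{\le j_r}^{-1},B_i^{-1})\begin{pmatrix}-\mathcal{C}^-_{\le i}&\mathcal{C}^+_{\le i}\end{pmatrix}^T+\mathcal{D}_{\le i}.$$ **Standing assumptions.** All $B_i$ and all $\mathcal{B}_{\le i}$ are invertible, and all $\mathcal{S}_{\le i}$ ($i$ inner) are positive definite. Moreover, with $\mathcal{B}=\mathrm{blkdiag}(B_1,\dots,B_N)$, $\mathcal{D}=\mathrm{blkdiag}(D_1,\dots,D_M)$ and $\mathcal{C}$ the block matrix whose block row for $a_k=(i,j)$ has $C_k^+$ in block column $i$,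 $-C_k^-$ in block column $j$ and zeros elsewhere, the matrix $\mathcal{C}\mathcal{B}^{-1}\mathcal{C}^T+\mathcal{D}$ is positive definite. **Hook preconditioner.** $\mathcal{P}^{\mathrm{hook}}_{\le i}=B_i$ for a leaf $i$, and for an inner vertex $i$ $$\mathcal{P}^{\mathrm{hook}}_{\le i}=\begin{pmatrix}\mathrm{blkdiag}(\mathcal{P}^{\mathrm{hook}}_{\le j_1},\dots,\mathcal{P}^{\mathrm{hook}}_{\le j_r}) & 0 & 0\\ 0 & B_i & 0\\ -\mathcal{C}^-_{\le i} & \mathcal{C}^+_{\le i} & -\mathcal{S}_{\le i}\end{pmatrix}.$$ **GMRES.** For a linear system $\mathcal{A}x=h$ with invertible $\mathcal{A}$, invertible preconditioner $\mathcal{P}$ and initial guess $x^{(0)}$, the $m$-th (preconditioned) GMRES iterate $x^{(m)}$ minimizes $\|\mathcal{P}^{-1}(h-\mathcal{A}x)\|_2$ over $x\in x^{(0)}+\mathrm{span}\{r,Tr,\dots,T^{m-1}r\}$, where $T=\mathcal{P}^{-1}\mathcal{A}$ and $r=\mathcal{P}^{-1}(h-\mathcal{A}x^{(0)})$. *)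

(* Defs.v *)
From Stdlib Require Import Wellfounded FunctionalExtensionality.
From mathcomp Require Import all_boot all_order all_algebra.
From mathcomp Require Import reals.

Set Implicit Arguments.
Unset Strict Implicit.
Unset Printing Implicit Defensive.

Import Order.TTheory GRing.Theory Num.Theory.
Local Open Scope ring_scope.

(* Vertices are 'I_N and arcs are 'I_M; arc k goes from [src k] to [tgt k]. *)
Record arborescence (N M : nat) := Arborescence {
  root : 'I_N;
  src : 'I_M -> 'I_N;
  tgt : 'I_M -> 'I_N;
  root_no_entering : forall k, tgt k != root;
  unique_entering : forall i, i != root -> exists! k, tgt k = i;
  root_reaches : forall i,
    connect [rel a b | [exists k, (src k == a) && (tgt k == b)]] root i
}.

Section Tree.
Variables (N M : nat) (T : arborescence N M).

Definition out_arcs (i : 'I_N) : {set 'I_M} := [set k | src T k == i].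

Definition leaf (i : 'I_N) : bool := out_arcs i == set0.

Definition nout (i : 'I_N) : nat := #|out_arcs i|.

(* The outgoing arcs k_1, ..., k_r of i, in increasing order, and their
   heads j_1, ..., j_r. *)
Definition arc (i : 'I_N) (s : 'I_(nout i)) : 'I_M := enum_val s.

Definition child (i : 'I_N) (s : 'I_(nout i)) : 'I_N := tgt T (arc s).

Definition child_of (j i : 'I_N) : Prop := exists k, src T k = i /\ tgt T k = j.

Lemma src_arc i (s : 'I_(nout i)) : src T (arc s) = i.
Proof. by have := enum_valP s; rewrite inE => /eqP. Qed.

Lemma child_ofP i (s : 'I_(nout i)) : child_of (child s) i.
Proof. by exists (arc s); split=> //; apply: src_arc. Qed.

Let e : rel 'I_N := [rel a b | [exists k, (src T k == a) && (tgt T k == b)]].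

Let path_size_unique (p q : seq 'I_N) :
  path e (root T) p -> path e (root T) q ->
  last (root T) p = last (root T) q -> size p = size q.
Proof.
have no_root x : ~~ e x (root T).
  apply/existsP=> -[k /andP[_ /eqP k_root]].
  by have := root_no_entering T k; rewrite k_root eqxx.
elim/last_ind: p q => [|p x IHp] q; case/lastP: q => [|q y] //.
- rewrite rcons_path last_rcons /= => _ /andP[_ ey] def_y.
  by move: ey; rewrite -def_y (negbTE (no_root _)).
- rewrite rcons_path last_rcons /= => /andP[_ ex] _ def_x.
  by move: ex; rewrite def_x (negbTE (no_root _)).
rewrite !rcons_path !last_rcons !size_rcons.
move=> /andP[pP ex] /andP[qP ey] def_x; congr _.+1; apply: IHp => //.
have x_root : x != root T by apply: contraTneq ex => ->; apply: no_root.
rewrite -def_x in ey.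
case/existsP: ex => k /andP[/eqP <- /eqP tk].
case/existsP: ey => k' /andP[/eqP <- /eqP tk'].
by have [k0 [_ uk0]] := unique_entering x_root; rewrite -(uk0 _ tk) (uk0 _ tk').
Qed.

Lemma child_of_wf : well_founded child_of.
Proof.
suff acc_path d p : path e (root T) p -> (N - size p <= d)%N ->
    Acc child_of (last (root T) p).
  move=> i; have /connectP[p pP ->] := root_reaches T i.
  exact: acc_path pP (leqnn _).
have short q : path e (root T) q -> (size q < N)%N.
  move=> qP; have [q' [q'P uq' eq_last]] : exists q',
      [/\ path e (root T) q', uniq (root T :: q')
        & last (root T) q = last (root T) q'].
    by case/shortenP: qP => q' q'P uq' _; exists q'.
  rewrite (path_size_unique qP q'P eq_last).
  by have := card_uniqP uq'; rewrite /= => <-; rewrite -[X in (_ <= X)%N]card_ord max_card.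
elim: d p => [|d IHd] p pP.
  by rewrite leqn0 subn_eq0 leqNgt (short _ pP).
move=> le_d; constructor=> j [k [sk tk]].
have rP : path e (root T) (rcons p j).
  by rewrite rcons_path pP /=; apply/existsP; exists k; rewrite sk tk !eqxx.
rewrite -(last_rcons (root T) p j); apply: IHd => //.
by rewrite size_rcons subnS -ltnS (leq_trans _ le_d) // prednK // subn_gt0 short.
Qed.

Definition height : 'I_N -> nat :=
  Fix child_of_wf (fun=> nat) (fun i rec =>
    if leaf i then 0%N
    else (\max_(s < nout i) rec (child s) (child_ofP s)).+1).

Lemma heightE i :
  height i = if leaf i then 0%N else (\max_(s < nout i) height (child s)).+1.
Proof.
rewrite /height Fix_eq // => j f g fg; case: ifP => // _.
by congr _.+1; apply: eq_bigr => s _; rewrite fg.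
Qed.

End Tree.

Record tree_data (R : realType) (N M : nat) (T : arborescence N M) := TreeData {
  vdim : 'I_N -> nat;
  adim : 'I_M -> nat;
  B_ : forall i, 'M[R]_(vdim i);
  D_ : forall k, 'M[R]_(adim k);
  Cp_ : forall k, 'M[R]_(adim k, vdim (src T k));
  Cm_ : forall k, 'M[R]_(adim k, vdim (tgt T k));
  B_sym : forall i, (B_ i)^T = B_ i;
  D_sym : forall k, (D_ k)^T = D_ k
}.

(* [\mxdiag] for rectangular diagonal blocks. *)
Definition blkdiag (R : realType) (r : nat) (p q : 'I_r -> nat)
    (A : forall s, 'M[R]_(p s, q s)) : 'M[R]_(\sum_s p s, \sum_s q s) :=
  \mxblock_(s < r, t < r)
    (if s == t then conform_mx (0 : 'M[R]_(p s, q t)) (A s) else 0).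

(* What the recursion computes at a vertex i with n_i = n: the size of B_{<=i},
   the matrices B_{<=i} and P^hook_{<=i}, and the operation which pads an
   l x n matrix with zeros so that it occupies the columns of the block B_i
   inside B_{<=i}; C^-_i is [npad] applied to the C^- of the arc entering i. *)
Record nested (R : realType) (n : nat) := Nested {
  ndim : nat;
  nB : 'M[R]_ndim;
  nhook : 'M[R]_ndim;
  npad : forall l, 'M[R]_(l, n) -> 'M[R]_(l, ndim)
}.

Section Data.
Variables (R : realType) (N M : nat) (T : arborescence N M) (X : tree_data R T).

Definition leaf_nested (i : 'I_N) : nested R (vdim X i) :=
  Nested (B_ X i) (B_ X i) (fun _ A => A).

Section Inner.
Variables (i : 'I_N) (ch : forall s : 'I_(nout T i), nested R (vdim X (child s))).

Definition inner_D : 'M[R]_(\sum_(s < nout T i) adim X (arc s)) :=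
  \mxdiag_(s < nout T i) D_ X (arc s).

(* The conversion is along src (arc s) = i, see [src_arc]. *)
Definition inner_Cp : 'M[R]_(\sum_(s < nout T i) adim X (arc s), vdim X i) :=
  \mxcol_(s < nout T i)
    conform_mx (0 : 'M[R]_(adim X (arc s), vdim X i)) (Cp_ X (arc s)).

(* Here arc s is the unique arc entering child s. *)
Definition inner_Cm :
    'M[R]_(\sum_(s < nout T i) adim X (arc s), \sum_(s < nout T i) ndim (ch s)) :=
  blkdiag (fun s => npad (ch s) (Cm_ X (arc s))).

Definition inner_C := row_mx (- inner_Cm) inner_Cp.

Definition inner_S : 'M[R]_(\sum_(s < nout T i) adim X (arc s)) :=
  inner_C
    *m block_mx (\mxdiag_(s < nout T i) invmx (nB (ch s))) 0 0 (invmx (B_ X i))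
    *m inner_C^T
  + inner_D.

Definition inner_B :=
  block_mx (block_mx (\mxdiag_(s < nout T i) nB (ch s)) 0 0 (B_ X i))
           (col_mx (- inner_Cm^T) inner_Cp^T)
           (row_mx (- inner_Cm) inner_Cp) (- inner_D).

Definition inner_hook :=
  block_mx (block_mx (\mxdiag_(s < nout T i) nhook (ch s)) 0 0 (B_ X i))
           0
           (row_mx (- inner_Cm) inner_Cp) (- inner_S).

Definition inner_pad l (A : 'M[R]_(l, vdim X i)) :=
  row_mx (row_mx (0 : 'M[R]_(l, \sum_(s < nout T i) ndim (ch s))) A)
         (0 : 'M[R]_(l, \sum_(s < nout T i) adim X (arc s))).

Definition inner_nested : nested R (vdim X i) :=
  Nested inner_B inner_hook inner_pad.

End Inner.

Definition nested_at : forall i, nested R (vdim X i) :=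
  Fix (@child_of_wf N M T) (fun i => nested R (vdim X i)) (fun i rec =>
    if leaf T i then leaf_nested i
    else inner_nested (fun s => rec (child s) (child_ofP s))).

Lemma nested_atE i :
  nested_at i = if leaf T i then leaf_nested i
                else inner_nested (fun s : 'I_(nout T i) => nested_at (child s)).
Proof.
rewrite /nested_at Fix_eq // => j f g fg; case: ifP => // _.
by congr inner_nested; apply: functional_extensionality_dep => s; apply: fg.
Qed.

Definition dim_le (i : 'I_N) : nat := ndim (nested_at i).

Definition B_le (i : 'I_N) : 'M[R]_(dim_le i) := nB (nested_at i).

Definition hook_le (i : 'I_N) : 'M[R]_(dim_le i) := nhook (nested_at i).

(* Meaningful for inner i only. *)
Definition S_le (i : 'I_N) : 'M[R]_(\sum_(s < nout T i) adim X (arc s)) :=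
  inner_S (fun s : 'I_(nout T i) => nested_at (child s)).

Definition glob_B : 'M[R]_(\sum_i vdim X i) := \mxdiag_(i < N) B_ X i.

Definition glob_D : 'M[R]_(\sum_k adim X k) := \mxdiag_(k < M) D_ X k.

Definition glob_C : 'M[R]_(\sum_k adim X k, \sum_i vdim X i) :=
  \mxblock_(k < M, i < N)
    (if i == src T k then conform_mx (0 : 'M[R]_(adim X k, vdim X i)) (Cp_ X k)
     else if i == tgt T k then
       - conform_mx (0 : 'M[R]_(adim X k, vdim X i)) (Cm_ X k)
     else 0).

End Data.

Definition posdef (R : realType) (n : nat) (A : 'M[R]_n) : Prop :=
  A^T = A /\ forall v : 'cV[R]_n, v != 0 -> 0 < (v^T *m A *m v) 0 0.

Definition norm2 (R : realType) (n : nat) (v : 'cV[R]_n) : R :=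
  Num.sqrt (\sum_i v i 0 ^+ 2).

Definition krylov (R : realType) (n : nat) (T : 'M[R]_n) (r : 'cV[R]_n)
    (m : nat) : {vspace 'cV[R]_n} :=
  <<mkseq (fun s => (T ^+ s) *m r) m>>%VS.

(* x is an m-th GMRES iterate for A x = h with preconditioner P and initial
   guess x0.  Invertibility is required explicitly because [invmx] is total. *)
Definition gmres_iterate (R : realType) (n : nat) (A P : 'M[R]_n)
    (h x0 : 'cV[R]_n) (m : nat) (x : 'cV[R]_n) : Prop :=
  let K := krylov (invmx P *m A) (invmx P *m (h - A *m x0)) m in
  [/\ A \in unitmx, P \in unitmx, x - x0 \in K
    & forall y, y - x0 \in K ->
        norm2 (invmx P *m (h - A *m x)) <= norm2 (invmx P *m (h - A *m y))].

(* Main.v *)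
Require Import Defs.
From mathcomp Require Import all_boot all_order all_algebra.
From mathcomp Require Import reals.
Local Open Scope ring_scope.

Import Order.TTheory GRing.Theory Num.Theory.

(** The children of a vertex [i] of height one are leaves, and at a leaf the
    hook preconditioner is the matrix itself.  Hence the preconditioner at [i]
    treats the leading block [K] of the matrix at [i] exactly: with
    [S = C K^-1 C^T + D] and block rows separated by semicolons, the matrix is
    [(K C^T; C -D)] and its preconditioner is [(K 0; C -S)].
    A block LU factorization then shows that the preconditioned matrix is the
    unipotent matrix [T = (1 K^-1 C^T; 0 1)]
    ([hook_preconditioned]), so that [(T - 1)^2 = 0].  The inverse of such a
    [T] is the polynomial [2 - T] of degree one, so that the initial error
    [T^-1 r = 2 r - T r] lies in the second Krylov space
    ([unipotent_krylov2]).  The exact solution is therefore among the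
    candidates of the second GMRES step; it has residual zero, and it is the
    only vector with this property because the matrices are invertible
    ([gmres_iterate_solution]). *)

(** * GMRES and Krylov spaces *)

Lemma norm2_eq0 (R : realType) (n : nat) (v : 'cV[R]_n) :
  norm2 v = 0 -> v = 0.
Proof.
move=> v0; have sum0 : \sum_i v i 0 ^+ 2 = 0.
  apply/eqP; rewrite eq_le; apply/andP; split.
    by rewrite -sqrtr_eq0; apply/eqP.
  by apply: sumr_ge0 => i _; apply: sqr_ge0.
apply/colP => i; rewrite mxE; apply/eqP; rewrite -sqrf_eq0; apply/eqP.
by apply: (psumr_eq0P _ sum0) => // j _; apply: sqr_ge0.
Qed.

(** Once the affine Krylov space contains the exact solution, the minimal
    residual is zero, and only the exact solution has residual zero. *)
Lemma gmres_iterate_solution (R : realType) (n : nat) (A P : 'M[R]_n)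
    (h x0 : 'cV[R]_n) (m : nat) :
  A \in unitmx -> P \in unitmx ->
  invmx A *m h - x0 \in krylov (invmx P *m A) (invmx P *m (h - A *m x0)) m ->
  forall x, gmres_iterate A P h x0 m x <-> x = invmx A *m h.
Proof.
move=> uA uP solK x.
have norm_sol : norm2 (invmx P *m (h - A *m (invmx A *m h))) = 0.
  rewrite mulKVmx // subrr mulmx0 /norm2 big1 ?sqrtr0 // => i _.
  by rewrite mxE expr0n.
split=> [[_ _ _ minx] | ->]; last first.
  by split=> // y _; rewrite norm_sol sqrtr_ge0.
have res0 : invmx P *m (h - A *m x) = 0.
  apply: norm2_eq0; apply/eqP; rewrite eq_le sqrtr_ge0 andbT -norm_sol.
  exact: minx.
have /eqP : h - A *m x = 0 by rewrite -[LHS](mulKVmx uP) res0 mulmx0.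
by rewrite subr_eq0 => /eqP ->; rewrite mulKmx.
Qed.

(** [(T - 1)^2 = 0] rearranges to [T (2 - T) = 1], so [z = T^-1 r] is a
    combination of [r] and [T r]. *)
Lemma unipotent_krylov2 (R : realType) (n : nat) (T : 'M[R]_n) (r z : 'cV[R]_n) :
  (T - 1%:M) *m (T - 1%:M) = 0 -> T *m z = r -> z \in krylov T r 2.
Proof.
move=> T1sq0 Tz; have -> : z = 2%:R *: r - T *m r.
  have /eqP : (T - 1%:M) *m ((T - 1%:M) *m z) = 0 by rewrite mulmxA T1sq0 mul0mx.
  rewrite !mulmxBl !mul1mx Tz mulmxBr Tz subr_eq0 => /eqP Trz.
  by rewrite scaler_nat mulr2n -addrA -opprB Trz subKr.
rewrite /krylov /mkseq /= expr0 expr1 mul1mx.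
apply: rpredB; first by apply/rpredZ/memv_span; rewrite inE eqxx.
by apply: memv_span; rewrite !inE eqxx orbT.
Qed.

(** * Invertibility and block matrices *)

Lemma posdef_unitmx (R : realType) (n : nat) (A : 'M[R]_n) :
  posdef A -> A \in unitmx.
Proof.
case=> _ posA; rewrite unitmxE unitfE; apply: contraT; rewrite negbK.
case/det0P => v v_neq0 vA0; have := posA v^T.
by rewrite trmxK vA0 mul0mx mxE ltxx trmx_eq0 => /(_ v_neq0).
Qed.

(** This is the block LU factorization
    [(K E; F -D) = (K 0; F -S) (1 K^-1 E; 0 1)]: the lower right entry of the
    product is [F K^-1 E - S = -D], by the choice of [S]. *)
Lemma hook_preconditioned (R : comUnitRingType) (p q : nat) (K : 'M[R]_p)
    (E : 'M[R]_(p, q)) (F : 'M[R]_(q, p)) (D : 'M[R]_q)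
    (S := F *m invmx K *m E + D) :
  K \in unitmx -> S \in unitmx ->
  block_mx K 0 F (- S) \in unitmx /\
  invmx (block_mx K 0 F (- S)) *m block_mx K E F (- D)
    = block_mx 1%:M (invmx K *m E) 0 1%:M.
Proof.
move=> uK uS; set P := block_mx _ _ _ (- S).
have uP : P \in unitmx.
  by rewrite unitmxE det_lblock unitrM -!unitmxE uK -scaleN1r unitmxZ ?unitrN1.
split=> //; rewrite -[RHS](mulKmx uP) mulmx_block.
rewrite !mulmx1 !mulmx0 !addr0 mulKVmx // mulmxA.
by rewrite /S opprD addNKr.
Qed.

Lemma unipotent_block_sq0 (R : pzRingType) (p q : nat) (Y : 'M[R]_(p, q)) :
  let T := block_mx 1%:M Y 0 1%:M in (T - 1%:M) *m (T - 1%:M) = 0.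
Proof.
rewrite /= [X in _ - X](scalar_mx_block p q) opp_block_mx add_block_mx.
rewrite !subrr !subr0 mulmx_block.
by rewrite !mul0mx !mulmx0 !addr0 block_mx0.
Qed.

(** Identifies the block diagonal of inverses occurring in the Schur complement
    with the inverse of the leading block. *)
Lemma invmx_mxdiag (R : comUnitRingType) (r : nat) (p : 'I_r -> nat)
    (A : forall s, 'M[R]_(p s)) :
  (forall s, A s \in unitmx) ->
  \mxdiag_(s < r) A s \in unitmx /\
  invmx (\mxdiag_(s < r) A s) = \mxdiag_(s < r) invmx (A s).
Proof.
move=> uA.
have AV1 : \mxdiag_(s < r) A s *m \mxdiag_(s < r) invmx (A s) = 1%:M.
  rewrite mul_mxdiag_mxblock -mxdiagZ; apply: eq_mxblock => s t.
  case: eqP => [eq_st | _]; last by rewrite mulmx0.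
  by case: _ / eq_st; rewrite !conform_mx_id mulmxV.
have [uD _] := mulmx1_unit AV1; split=> //.
by rewrite -[RHS](mulKmx uD) AV1 mulmx1.
Qed.

(** * The vertices of height one *)

(** The assumption on the children is what makes the leading blocks of the
    matrix and of its preconditioner agree; at greater height it fails in
    general, because the hook matrix of an inner child is only block triangular. *)
Lemma gmres2_exact_children (R : realType) (N M : nat) (T : arborescence N M)
    (X : tree_data R T) (i : 'I_N)
    (ch : forall s : 'I_(nout T i), nested R (vdim X (child s)))
    (h x0 : 'cV[R]_(ndim (inner_nested ch))) :
  (forall s, nhook (ch s) = nB (ch s)) ->
  (forall s, nB (ch s) \in unitmx) -> B_ X i \in unitmx ->
  inner_B ch \in unitmx -> inner_S ch \in unitmx ->
  forall x, gmres_iterate (inner_B ch) (inner_hook ch) h x0 2 x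
    <-> x = invmx (inner_B ch) *m h.
Proof.
move=> hook_nB uch uBi uB uS.
have [uchs invchs] := @invmx_mxdiag _ _ _ _ uch.
set K := block_mx (\mxdiag_(s < nout T i) nB (ch s)) 0 0 (B_ X i).
have uK : K \in unitmx by rewrite block_diag_mx_unit uchs.
have SE : inner_S ch
    = inner_C ch *m invmx K *m (inner_C ch)^T + inner_D X i.
  by rewrite invmx_block_diag // invchs.
have BE : inner_B ch = block_mx K (inner_C ch)^T (inner_C ch) (- inner_D X i).
  by rewrite /inner_C tr_row_mx linearN.
have hookE : inner_hook ch = block_mx K 0 (inner_C ch) (- inner_S ch).
  by rewrite /inner_hook (eq_mxdiag hook_nB).
have [uP PB] : inner_hook ch \in unitmx /\ invmx (inner_hook ch) *m inner_B ch
    = block_mx 1%:M (invmx K *m (inner_C ch)^T) 0 1%:M.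
  by rewrite hookE BE SE; apply: hook_preconditioned; rewrite -?SE.
apply: gmres_iterate_solution => //; apply: unipotent_krylov2.
  by rewrite PB unipotent_block_sq0.
(* T applied to the initial error is the preconditioned initial residual. *)
by rewrite -mulmxA mulmxBr mulKVmx.
Qed.

Theorem corollary3p2 (R : realType) (N M : nat) (T : arborescence N M)
    (X : tree_data R T)
    (hB : forall j, B_ X j \in unitmx)
    (hBle : forall j, B_le X j \in unitmx)
    (hSle : forall j, ~~ leaf T j -> posdef (S_le X j))
    (hglob : posdef (glob_C X *m invmx (glob_B X) *m (glob_C X)^T + glob_D X))
    (i : 'I_N) (hi : height T i = 1%N) (h x0 : 'cV[R]_(dim_le X i)) :
  exists2 m : nat, (m <= 2)%N &
    forall x : 'cV[R]_(dim_le X i),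
      gmres_iterate (B_le X i) (hook_le X i) h x0 m x <->
      x = invmx (B_le X i) *m h.
Proof.
exists 2%N => //.
have inner_i : ~~ leaf T i by move: hi; rewrite heightE; case: leaf.
have leaf_child (s : 'I_(nout T i)) : leaf T (child s).
  apply: contraT => inner_s.
  have := @leq_bigmax 'I_(nout T i) (fun s => height T (child s)) s.
  move: hi; rewrite heightE (negbTE inner_i) => -[->].
  by rewrite heightE (negbTE inner_s).
have uS := @posdef_unitmx _ _ _ (hSle i inner_i).
move: (hBle i) h x0; rewrite /B_le /hook_le /dim_le nested_atE (negbTE inner_i).
move=> uB h x0; apply: gmres2_exact_children => // s;
  rewrite nested_atE leaf_child //.
exact: hB.
Qed.
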